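(* Let $(X,P)\in\mathcal{M}$ and $(\dot X,\dot P)\in\mathrm{T}_{(X,P)}\mathcal{M}$ have representations $(U,\Sigma,V)$ and $(K,V_p)$. Define $D\in\mathrm{Sym}(2r)$ by $$D=\begin{bmatrix}\Sigma^2+\Sigma U^\top K+K^\top U\Sigma+K^\top K+2\alpha I & \Sigma^2+K^\top U\Sigma+2\alpha I\\ \Sigma^2+\Sigma U^\top K+2\alpha I&\Sigma^2\end{bmatrix}.$$ Perform the following procedure: (1) compute a thin QR decomposition $[V\ \ V_p]=QR$, with $Q\in\mathrm{St}(n,q)$, $R\in\mathbb{R}^{q\times2r}$, $q=\min(n,2r)$; (2) let $\tilde U\in\mathrm{St}(q,r)$ contain $r$ orthonormal eigenvectors of $RDR^\top$ associated with its $r$ largest eigenvalues; (3) let $\tilde V=Q\tilde U$; (4) compute a thin SVD $(X+\dot X)\tilde V=\bar U\bar\Sigma H^\top$ with $\bar U\in\mathrm{St}(m,r)$, $\bar\Sigma\in\mathbb{R}^{r\times r}$ diagonal with nonnegative non-increasing entries, $H\in\mathbb{R}^{r\times r}$ orthogonal; (5) output $(\bar U,\bar\Sigma,\bar V)$ with $\bar V=\tilde VH$. Then the output is a representation of a metric projection retraction at $(X,P)$ in direction $(\dot X,\dot P)$, that is, the point $(\bar U\bar\Sigma\bar V^\top,\ I-\bar V\bar V^\top)$ belongs to $$\operatorname*{arg\,min}_{(\bar X,\bar P)\in\mathcal{M}}\ \|X+\dot X-\bar X\|_{\mathrm F}^2+\alpha\|P+\dot P-\bar P\|_{\mathrm F}^2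 .$$
   Context: Let $m,n,r$ be positive integers with $r<\min(m,n)$ and $\alpha>0$. $\mathrm{Sym}(n)$: real symmetric $n\times n$ matrices; $\mathrm{St}(n,r)=\{V\in\mathbb{R}^{n\times r}:V^\top V=I_r\}$; $\mathrm{Gr}(n,n-r)=\{P\in\mathrm{Sym}(n):P^2=P,\ \mathrm{rank}\,P=n-r\}$. The desingularization $\mathcal{M}=\{(X,P)\in\mathbb{R}^{m\times n}\times\mathrm{Gr}(n,n-r):XP=0\}$ is a smooth embedded submanifold of $\mathbb{R}^{m\times n}\times\mathrm{Sym}(n)$. A representation of $(X,P)\in\mathcal{M}$ is a triplet $(U,\Sigma,V)$ with $U\in\mathrm{St}(m,r)$, $V\in\mathrm{St}(n,r)$, $\Sigma\in\mathbb{R}^{r\times r}$ diagonal with nonnegative, non-increasing diagonal entries, such that $X=U\Sigma V^\top$ and $P=I-VV^\top$ (one always exists). Given it, a representation of $(\dot X,\dot P)\in\mathrm{T}_{(X,P)}\mathcal{M}$ is the (unique) pair $(K,V_p)\in\mathbb{R}^{m\times r}\times\mathbb{R}^{n\times r}$ with $V_p^\top V=0$, $\dot X=KV^\top+U\Sigma V_p^\top$, $\dot P=-V_pV^\top-VV_p^\top$; all tangent vectors, and only they, are of this form. *)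

(* Defs.v *)
From HB Require Import structures.
From mathcomp Require Import all_boot all_order all_algebra.
From mathcomp Require Import all_classical all_reals all_analysis.

Set Implicit Arguments.
Unset Strict Implicit.
Unset Printing Implicit Defensive.

Import Order.TTheory GRing.Theory Num.Theory.
Import numFieldNormedType.Exports.

Local Open Scope classical_set_scope.
Local Open Scope ring_scope.

(** * Matrix manifolds *)

Definition stiefel (R : realType) (n r : nat) : set 'M[R]_(n, r) :=
  [set V | V^T *m V = 1%:M].

Definition grassmann (R : realType) (n d : nat) : set 'M[R]_n :=
  [set P | [/\ P^T = P, P *m P = P & \rank P = d]].

Definition desingularization (R : realType) (m n r : nat) :
    set ('M[R]_(m, n) * 'M[R]_n) :=
  [set x | grassmann (n - r) x.2 /\ x.1 *m x.2 = 0].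

Definition smooth_near (R : realType) (V : normedModType R) (c : R -> V)
    (t0 : R) : Prop :=
  \forall t \near t0, forall k : nat, derivable (derive1n k c) t 1.

(** For an embedded submanifold [M], the tangent space at [x] is the set of
    velocities at [0] of the curves in [M] through [x] that are smooth
    around [0]. *)
Definition tangent_space (R : realType) (V : normedModType R) (M : set V)
    (x : V) : set V :=
  [set v | exists c : R -> V,
     [/\ smooth_near c 0, \forall t \near 0, M (c t), c 0 = x
       & is_derive (0 : R) 1 c v]].

(** * Representations *)

Definition is_singular_value_mx (R : realType) (r : nat) (S : 'M[R]_r) : Prop :=
  [/\ is_diag_mx S, (forall i, 0 <= S i i)
    & (forall i j : 'I_r, (i <= j)%N -> S j j <= S i i)].

Definition is_representation (R : realType) (m n r : nat)
    (x : 'M[R]_(m, n) * 'M[R]_n)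
    (U : 'M[R]_(m, r)) (S : 'M[R]_r) (V : 'M[R]_(n, r)) : Prop :=
  [/\ stiefel U, stiefel V, is_singular_value_mx S,
      x.1 = U *m S *m V^T & x.2 = 1%:M - V *m V^T].

(** [K], [Vp] represent [v], relative to the representation [U], [S], [V] of
    the base point. *)
Definition is_tangent_representation (R : realType) (m n r : nat)
    (U : 'M[R]_(m, r)) (S : 'M[R]_r) (V : 'M[R]_(n, r))
    (v : 'M[R]_(m, n) * 'M[R]_n)
    (K : 'M[R]_(m, r)) (Vp : 'M[R]_(n, r)) : Prop :=
  [/\ Vp^T *m V = 0, v.1 = K *m V^T + U *m S *m Vp^T
    & v.2 = - (Vp *m V^T) - V *m Vp^T].

(** * Matrix factorizations *)

Definition is_thin_qr (R : realType) (n p : nat) (A : 'M[R]_(n, p))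
    (Q : 'M[R]_(n, minn n p)) (T : 'M[R]_(minn n p, p)) : Prop :=
  [/\ stiefel Q,
      (forall (i : 'I_(minn n p)) (j : 'I_p), (j < i)%N -> T i j = 0)
    & A = Q *m T].

(** [s] lists the eigenvalues of [A] with multiplicity, in non-increasing order;
    the columns of [W] may be in any order. *)
Definition is_top_eigenvectors (R : realType) (q r : nat) (A : 'M[R]_q)
    (W : 'M[R]_(q, r)) : Prop :=
  stiefel W /\
  exists (s : seq R) (mu : 'rV[R]_r),
    [/\ sorted >=%R s, char_poly A = \prod_(x <- s) ('X - x%:P),
        perm_eq [seq mu 0 j | j : 'I_r] (take r s)
      & A *m W = W *m diag_mx mu].

Definition is_thin_svd (R : realType) (m r : nat) (A : 'M[R]_(m, r))
    (U : 'M[R]_(m, r)) (S : 'M[R]_r) (H : 'M[R]_r) : Prop :=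
  [/\ stiefel U, is_singular_value_mx S, stiefel H & A = U *m S *m H^T].

(** * The metric projection *)

Definition fnorm (R : realType) (m n : nat) (A : 'M[R]_(m, n)) : R :=
  Num.sqrt (\sum_i \sum_j A i j ^+ 2).

Definition argmin (R : realType) (T : Type) (M : set T) (f : T -> R) : set T :=
  [set x | M x /\ forall y, M y -> f x <= f y].

Definition metric_projection (R : realType) (m n r : nat) (alpha : R)
    (y : 'M[R]_(m, n) * 'M[R]_n) : set ('M[R]_(m, n) * 'M[R]_n) :=
  argmin (@desingularization R m n r)
    (fun z => fnorm (y.1 - z.1) ^+ 2 + alpha * fnorm (y.2 - z.2) ^+ 2).

Definition Dmx (R : realType) (m r : nat) (alpha : R)
    (U : 'M[R]_(m, r)) (S : 'M[R]_r) (K : 'M[R]_(m, r)) : 'M[R]_(r + r) :=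
  block_mx
    (S *m S + S *m U^T *m K + K^T *m U *m S + K^T *m K + (2 * alpha)%:M)
    (S *m S + K^T *m U *m S + (2 * alpha)%:M)
    (S *m S + S *m U^T *m K + (2 * alpha)%:M)
    (S *m S).

(* Main.v *)
Require Import Defs.
From mathcomp Require Import all_boot all_order all_algebra.
From mathcomp Require Import all_classical all_reals all_analysis.
From mathcomp Require Import complex ring lra.
Import Order.TTheory GRing.Theory Num.Theory.
Import numFieldNormedType.Exports.
Local Open Scope classical_set_scope.
Local Open Scope ring_scope.

(* Writing a competitor as (Xb, 1 - Pi) with Pi an orthogonal projection of rank
   r, the cost is a constant minus tr (M Pi) plus |(X + Xdot) Pi - Xb|^2, where
   M = [V Vp] D [V Vp]^T = Q N Q^T and N = T D T^T.  So one takes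
   Xb = (X + Xdot) Pi and maximizes tr (M Pi) = tr (N (Q^T Pi Q)).  Here
   Q^T Pi Q lies between 0 and 1 and has trace at most r, possibly less than r
   when q < n; Ky Fan's inequality still bounds the trace by the sum of the r
   largest eigenvalues of N provided these are nonnegative.  They are, because N
   is positive semidefinite on the r-dimensional range of Q^T V, where it is the
   upper left block (U S + K)^T (U S + K) + 2 alpha of D. *)

(** * Eigenvalue bounds, deflation and Ky Fan's inequality *)

(** The spectral theorem for normal matrices, applied over [R[i]], turns the form into a sum of
    eigenvalues weighted by squared moduli of coordinates. *)
Lemma quadratic_form_le_max_eigenvalue {R : rcfType} {q : nat} (A : 'M[R]_q)
    (s : seq R) (t : R) (v : 'rV[R]_q) :
  A^T = A -> char_poly A = \prod_(x <- s) ('X - x%:P) ->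
  {in s, forall x, x <= t} ->
  (v *m A *m v^T) 0 0 <= t * (v *m v^T) 0 0.
Proof.
move=> Asym charA s_le.
pose f : {rmorphism R -> R[i]} := real_complex R.
pose Ac := map_mx f A; pose vc := map_mx f v.
have conjf k l (B : 'M[R]_(k, l)) : map_mx Num.conj (map_mx f B) = map_mx f B.
  by apply/matrixP=> i j; rewrite !mxE; apply: conj_Creal; rewrite complex_real.
have /orthomx_spectralP : Ac \is normalmx.
  have AcT : Ac^T = Ac by rewrite /Ac map_trmx Asym.
  by apply/normalmxP; rewrite AcT conjf.
set W := spectralmx Ac; set d := spectral_diag Ac => Ac_eq.
have W_unitary : W \is unitarymx by exact: spectral_unitarymx.
have W_unit := unitarymx_unit W_unitary.
have WAc : W *m Ac = diag_mx d *m W by rewrite Ac_eq !mulmxA mulmxV // mul1mx.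
(* [char_poly Ac] is the image of a polynomial that splits over [R] with roots [s], so each complex
   eigenvalue is some [f x] with [x] in [s]. *)
have d_le i : d 0 i <= f t.
  have : eigenvalue Ac (d 0 i).
    apply/eigenvalueP; exists (row i W); last first.
      apply/eqP => Wi0; have := congr1 (mulmx^~ (invmx W)) Wi0.
      rewrite -row_mul mulmxV // mul0mx => /rowP/(_ i)/eqP.
      by rewrite !mxE eqxx oner_eq0.
    by rewrite -row_mul WAc row_mul row_diag_mx -scalemxAl -rowE.
  rewrite eigenvalue_root_char -map_char_poly charA rmorph_prod /=.
  rewrite (eq_bigr (fun x => 'X - (f x)%:P)); last first.
    by move=> x _; rewrite rmorphB /= map_polyX map_polyC.
  rewrite -(big_map f xpredT (fun x => 'X - x%:P)) root_prod_XsubC.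
  by case/mapP=> x xs ->; rewrite lecR s_le.
(* The coordinates of [v] in the orthonormal eigenbasis formed by the rows of [W]. *)
pose z := vc *m W^t*%sesqui.
have vcE : vc = z *m W by rewrite mulmxKtV.
have vcTE : vc^T = W^t*%sesqui *m z^t*%sesqui.
  rewrite -map_mxM -trmx_mul -vcE.
  by rewrite /vc map_trmx conjf.
have WW : W *m W^t*%sesqui = 1%:M by apply/unitarymxP.
have vvE : f ((v *m v^T) 0 0) = \sum_i `|z 0 i| ^+ 2.
  transitivity ((vc *m vc^T) 0 0); first by rewrite /vc map_trmx -map_mxM [RHS]mxE.
  rewrite vcTE vcE mulmxA mulmxtVK //.
  rewrite mxE; apply: eq_bigr => i _.
  by rewrite !mxE normCK.
have vAvE : f ((v *m A *m v^T) 0 0) = \sum_i d 0 i * `|z 0 i| ^+ 2.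
  transitivity ((vc *m Ac *m vc^T) 0 0).
    by rewrite /vc map_trmx -!map_mxM [RHS]mxE.
  rewrite vcTE vcE -(mulmxA z) WAc !mulmxA mulmxtVK //.
  rewrite mul_mx_diag mxE; apply: eq_bigr => i _.
  by rewrite !mxE normCK mulrA (mulrC (d 0 i)).
rewrite -lecR -/f rmorphM /= vvE vAvE mulr_sumr; apply: ler_sum => i _.
by rewrite ler_wpM2r // exprn_ge0.
Qed.

(* [B] need not be invertible: compute the determinant of [L] times
   [block_mx 1 (W *m E) 0 B] in two ways. *)
Lemma det_add_lowrank {R : comNzRingType} {q r : nat} (A : 'M[R]_q)
    (W : 'M[R]_(q, r)) (W' : 'M[R]_(r, q)) (B E : 'M[R]_r) :
  A *m W = W *m B -> W' *m W = 1%:M -> B *m E = E *m B ->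
  \det (A + W *m E *m W') * \det B = \det A * \det (B + E).
Proof.
move=> AW WW BE.
pose L := block_mx A (- (W *m E)) W' 1%:M.
have detL : \det L = \det (A + W *m E *m W').
  have : L *m block_mx 1%:M 0 (- W') 1%:M =
         block_mx (A + W *m E *m W') (- (W *m E)) 0 1%:M.
    rewrite mulmx_block !mulmx1 !mulmx0 !mulmxN !mulNmx mul1mx opprK !add0r.
    by rewrite subrr.
  move/(congr1 determinant); rewrite det_mulmx det_lblock det_ublock !det1.
  by rewrite !mulr1.
have : L *m block_mx 1%:M (W *m E) 0 B = block_mx A 0 W' (B + E).
  rewrite mulmx_block !mulmx1 !mulmx0 !addr0 !mul1mx !mulNmx !mulmxA AW WW.
  by rewrite -!mulmxA BE subrr mul1mx addrC.
by move/(congr1 determinant); rewrite det_mulmx det_lblock det_ublock det1 mul1r detL.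
Qed.

(** The deflation moves the eigenvalues [mu] to [t] and keeps the others. This is [det_add_lowrank]
    for ['X - A], where [B + E] becomes the scalar matrix ['X - t]; cross-multiplying avoids
    polynomial division. *)
Lemma char_poly_deflation {R : comNzRingType} {q r : nat} (A : 'M[R]_q)
    (W : 'M[R]_(q, r)) (mu : 'rV[R]_r) (t : R) :
  W^T *m W = 1%:M -> A *m W = W *m diag_mx mu ->
  char_poly (A - W *m diag_mx (mu - const_mx t) *m W^T)
    * \prod_j ('X - (mu 0 j)%:P) =
  char_poly A * ('X - t%:P) ^+ r.
Proof.
move=> WW AW; pose Wp := map_mx polyC W; pose mup := map_mx polyC mu.
pose E := diag_mx (mup - const_mx t%:P); pose B := 'X%:M - diag_mx mup.
have detB : \det B = \prod_j ('X - (mu 0 j)%:P).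
  rewrite /B -diag_const_mx -linearB det_diag.
  by apply: eq_bigr => j _; rewrite !mxE.
have BE : B + E = ('X - t%:P)%:M.
  by rewrite /B /E; apply/matrixP=> i j; rewrite !mxE; case: eqP => _;
    rewrite ?mulr1n ?mulr0n; ring.
have -> : char_poly (A - W *m diag_mx (mu - const_mx t) *m W^T)
    = \det (char_poly_mx A + Wp *m E *m Wp^T).
  congr (\det _); rewrite /char_poly_mx map_mxB opprB addrA addrAC; congr (_ + _).
  rewrite !map_mxM map_trmx map_diag_mx map_mxB.
  by rewrite map_const_mx.
rewrite -detB det_add_lowrank ?BE ?det_scalar //.
- rewrite /char_poly_mx mulmxBl -map_mxM AW map_mxM map_diag_mx mulmxBr.
  by rewrite mul_scalar_mx mul_mx_scalar.
- by rewrite map_trmx -map_mxM WW map_mx1.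
- by rewrite mulmxBl mulmxBr mul_scalar_mx mul_mx_scalar diag_mxC.
Qed.

(** With [t] the least of the [r] largest eigenvalues, lowering all of these to [t] leaves a matrix
    whose spectrum is bounded by [t]. *)
Lemma top_eigenvectors_deflation {R : realType} {q r : nat} (A : 'M[R]_q)
    (W : 'M[R]_(q, r)) :
  (0 < r <= q)%N -> A^T = A -> is_top_eigenvectors A W ->
  exists (mu : 'rV[R]_r) (t : R),
    [/\ A *m W = W *m diag_mx mu, (forall j, t <= mu 0 j),
        (exists j, mu 0 j = t)
      & forall v : 'rV[R]_q,
          (v *m (A - W *m diag_mx (mu - const_mx t) *m W^T) *m v^T) 0 0
            <= t * (v *m v^T) 0 0].
Proof.
move=> /andP[r_gt0 r_le] Asym [WW [s [mu [s_sorted charA mu_s AW]]]].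
have size_s : size s = q.
  by apply: succn_inj; rewrite -(size_char_poly A) charA size_prod_XsubC.
have last_lt : (r.-1 < size s)%N by rewrite size_s prednK.
(* The [r]-th largest eigenvalue, counting from 0; the default is never reached, since
   [0 < r <= q]. *)
pose t := nth 0 s r.-1.
have s_anti : {in gtn (size s) &, forall i j, (i <= j)%N -> nth 0 s j <= nth 0 s i}.
  move=> i j i_lt j_lt; apply: (sorted_leq_nth _ _ 0 s_sorted) => //.
    by move=> ? ? ?; exact: ge_trans.
  by move=> ?; exact: lexx.
have size_take_s : size (take r s) = r by rewrite size_take size_s; case: ltngtP r_le.
have mem_mu j : mu 0 j \in take r s.
  by rewrite -(perm_mem mu_s); apply/mapP; exists j; rewrite ?mem_enum.
exists mu, t; split=> //.
- move=> j; have /(nthP 0)[k] := mem_mu j.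
  rewrite size_take_s => k_lt <-; rewrite nth_take //; apply: s_anti => //.
    by rewrite !inE size_s (leq_trans k_lt).
  by rewrite -ltnS prednK.
- have : t \in take r s.
    by apply/(nthP 0); exists r.-1; rewrite ?size_take_s ?nth_take ?prednK.
  by rewrite -(perm_mem mu_s) => /mapP[j _ ->]; exists j.
(* The deflated spectrum: the [q - r] lower eigenvalues and [r] copies of [t]. *)
move=> v; apply: (@quadratic_form_le_max_eigenvalue _ _ _ (drop r s ++ nseq r t)).
- by rewrite linearB /= !trmx_mul trmxK tr_diag_mx Asym mulmxA.
- have := char_poly_deflation A W mu t WW AW.
  have -> : \prod_j ('X - (mu 0 j)%:P) = \prod_(x <- take r s) ('X - x%:P).
    by rewrite -(perm_big _ mu_s) big_map big_enum.
  have -> : char_poly A = \prod_(x <- take r s) ('X - x%:P)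
      * \prod_(x <- drop r s) ('X - x%:P) by rewrite -big_cat cat_take_drop.
  rewrite big_cat /= big_nseq -Monoid.iteropE -mulrA mulrC => /mulfI; apply.
  by rewrite monic_neq0 // monic_prod_XsubC.
move=> x; rewrite mem_cat => /orP[|/nseqP[->]] // /(nthP 0)[k].
rewrite size_drop size_s => k_lt <-; rewrite nth_drop; apply: s_anti.
- by [].
- by rewrite inE size_s -ltn_subRL.
- exact: leq_trans (leq_pred _) (leq_addr _ _).
Qed.

Lemma row_congrE {R : comNzRingType} {q p : nat} (A : 'M[R]_q)
    (C : 'M[R]_(p, q)) (i : 'I_p) :
  (row i C *m A *m (row i C)^T) 0 0 = (C *m A *m C^T) i i.
Proof. by rewrite tr_row -!row_mul colE mulmxA -colE [LHS]mxE [LHS]mxE. Qed.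

Lemma dotmx_ge0 {R : realDomainType} {q : nat} (v : 'rV[R]_q) :
  0 <= (v *m v^T) 0 0.
Proof. by rewrite mxE sumr_ge0 // => i _; rewrite mxE sqr_ge0. Qed.

Lemma dotmx_eq0 {R : realDomainType} {q : nat} (v : 'rV[R]_q) :
  ((v *m v^T) 0 0 == 0) = (v == 0).
Proof.
apply/idP/eqP => [|->]; last by rewrite mul0mx mxE.
rewrite mxE psumr_eq0; last by move=> i _; rewrite mxE sqr_ge0.
move/allP => v0; apply/rowP => i; have := v0 i (mem_index_enum i).
by rewrite !mxE -expr2 sqrf_eq0 => /eqP.
Qed.

(* If the smallest top eigenvalue [t] were negative, then dropping its
   eigenvector from [W] would leave [r - 1] columns, and some nonzero vector in
   the range of [Z] would be orthogonal to all of them. *)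
Lemma least_top_eigenvalue_ge0 {R : realFieldType} {q r : nat} (A : 'M[R]_q)
    (W Z : 'M[R]_(q, r)) (mu : 'rV[R]_r) (t : R) :
  Z^T *m Z = 1%:M ->
  (forall v : 'rV[R]_r, 0 <= (v *m (Z^T *m A *m Z) *m v^T) 0 0) ->
  (exists j, mu 0 j = t) ->
  (forall v : 'rV[R]_q,
     (v *m (A - W *m diag_mx (mu - const_mx t) *m W^T) *m v^T) 0 0
       <= t * (v *m v^T) 0 0) ->
  0 <= t.
Proof.
move=> ZZ Z_psd [j mu_j] A_le; set E := diag_mx _ in A_le.
have detE : \det E = 0.
  by rewrite det_diag (bigD1 j) //= !mxE mu_j subrr mul0r.
(* The vector [v *m Z^T] is annihilated by the deflation term, so on it the deflated form agrees
   with that of [A], which is nonnegative there. *)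
have /eqP/det0P[v v_neq0 vE] : \det (Z^T *m W *m E) = 0.
  by rewrite det_mulmx detE mulr0.
have norm_v : (v *m Z^T) *m (v *m Z^T)^T = v *m v^T.
  by rewrite trmx_mul trmxK mulmxA -(mulmxA v) ZZ mulmx1.
have := A_le (v *m Z^T); rewrite norm_v.
have -> : v *m Z^T *m (A - W *m E *m W^T) *m (v *m Z^T)^T
    = v *m (Z^T *m A *m Z) *m v^T.
  rewrite trmx_mul trmxK mulmxBr !mulmxA.
  by move: vE; rewrite !mulmxA => ->; rewrite mul0mx subr0.
move/(le_trans (Z_psd v)); rewrite pmulr_lge0 //.
by rewrite lt_neqAle eq_sym dotmx_eq0 v_neq0 dotmx_ge0.
Qed.

(** Split [A = B + W *m E *m W^T], with [B] the deflated matrix. The first part contributes at most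
    [t * r], the second at most the sum of the [mu 0 j - t]. The matrix [Z] serves to give
    [0 <= t]. *)
Lemma trace_le_top_eigenvectors {R : realType} {q r p : nat} (A : 'M[R]_q)
    (W Z : 'M[R]_(q, r)) (C : 'M[R]_(q, p)) :
  (0 < r <= q)%N -> A^T = A -> is_top_eigenvectors A W ->
  Z^T *m Z = 1%:M ->
  (forall v : 'rV[R]_r, 0 <= (v *m (Z^T *m A *m Z) *m v^T) 0 0) ->
  \tr (C^T *m C) <= r%:R ->
  (forall v : 'rV[R]_q, (v *m (C *m C^T) *m v^T) 0 0 <= (v *m v^T) 0 0) ->
  \tr (C^T *m A *m C) <= \tr (W^T *m A *m W).
Proof.
move=> r_q Asym topW ZZ Z_psd trC C_le.
have [mu [t [AW mu_ge mu_t A_le]]] := top_eigenvectors_deflation A W r_q Asym topW.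
have t_ge0 := least_top_eigenvalue_ge0 A W Z mu t ZZ Z_psd mu_t A_le.
have [WW _] := topW.
set B := A - _ in A_le; set E := diag_mx _ in B A_le.
have -> : \tr (W^T *m A *m W) = t * r%:R + \sum_j (mu 0 j - t).
  rewrite -mulmxA AW mulmxA WW mul1mx mxtrace_diag sumrB sumr_const card_ord.
  by rewrite mulr_natr addrC subrK.
have -> : \tr (C^T *m A *m C) = \tr (C^T *m B *m C) + \tr (C^T *m (W *m E *m W^T) *m C).
  by rewrite -mxtraceD -mulmxDl -mulmxDr /B subrK.
apply: lerD.
  (* The sign of [t] matters here, as [\tr (C^T *m C)] may be smaller than [r]. *)
  apply: (@le_trans _ _ (t * \tr (C^T *m C))); last exact: ler_wpM2l.
  rewrite mulr_sumr; apply: ler_sum => i _.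
  have := A_le (row i C^T); rewrite row_congrE trmxK.
  by rewrite -{1}[row i C^T]mulmx1 row_congrE trmxK mulmx1.
(* By cyclicity, the nonnegative weights [mu 0 j - t] multiply the diagonal entries of
   [W^T *m (C *m C^T) *m W], each at most 1. *)
have -> : \tr (C^T *m (W *m E *m W^T) *m C)
    = \tr (E *m (W^T *m (C *m C^T) *m W)).
  rewrite !mulmxA mxtrace_mulC !mulmxA mxtrace_mulC !mulmxA mxtrace_mulC.
  by rewrite !mulmxA.
apply: ler_sum => j _.
have E_j : (mu - const_mx t) 0 j = mu 0 j - t by rewrite !mxE.
rewrite mul_diag_mx mxE E_j -[leRHS]mulr1.
apply: ler_wpM2l; first by rewrite subr_ge0.
have := C_le (row j W^T); rewrite row_congrE trmxK => /le_trans; apply.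
by rewrite -{1}[row j W^T]mulmx1 row_congrE trmxK mulmx1 WW mxE eqxx.
Qed.

(** * Frobenius norm, orthogonal projections and the cost *)

Lemma fnorm_sqr {R : realType} {m n : nat} (A : 'M[R]_(m, n)) :
  fnorm A ^+ 2 = \tr (A^T *m A).
Proof.
rewrite sqr_sqrtr; last by do 2![apply: sumr_ge0 => ? _]; exact: sqr_ge0.
rewrite exchange_big; apply: eq_bigr => j _; rewrite mxE.
by apply: eq_bigr => i _; rewrite mxE.
Qed.

Lemma fnorm_sqrB {R : realType} {m n : nat} (A B : 'M[R]_(m, n)) :
  fnorm (A - B) ^+ 2 = fnorm A ^+ 2 - 2 * \tr (A^T *m B) + fnorm B ^+ 2.
Proof.
rewrite !fnorm_sqr [(A - B)^T]linearB /= mulmxBl !mulmxBr !raddfB /=.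
have -> : \tr (B^T *m A) = \tr (A^T *m B).
  by rewrite -[LHS]mxtrace_tr trmx_mul trmxK.
ring.
Qed.

(** In a full rank factorization [P = C *m L], idempotence forces [L *m C = 1]; the trace is
    cyclic. *)
Lemma mxtrace_idempotent {F : fieldType} {n : nat} (P : 'M[F]_n) :
  P *m P = P -> \tr P = (\rank P)%:R.
Proof.
move=> PP; have := (mulmx_base P, col_base_full P, row_base_free P).
move: (col_base P) (row_base P) => C L [[CL C_full] L_free].
have LC : L *m C = 1%:M.
  apply: (row_free_inj L_free); rewrite mul1mx; apply: (row_full_inj C_full).
  by rewrite !mulmxA CL -mulmxA CL PP.
by rewrite -{1}CL mxtrace_mulC LC mxtrace1.
Qed.

(** The gap between the two sides is the squared norm of [A - Pi *m A]. *)
Lemma mxtrace_projection_le {R : realType} {n p : nat} (Pi : 'M[R]_n)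
    (A : 'M[R]_(n, p)) :
  Pi^T = Pi -> Pi *m Pi = Pi -> \tr (A^T *m Pi *m A) <= \tr (A^T *m A).
Proof.
move=> PiT PiPi; have := sqr_ge0 (fnorm (A - Pi *m A)).
rewrite fnorm_sqrB (fnorm_sqr (Pi *m A)) trmx_mul PiT !mulmxA.
rewrite -(mulmxA A^T Pi Pi) PiPi fnorm_sqr; lra.
Qed.

(* Since [Xb *m Pi = Xb], the matrix [Y *m Pi] is the best first component
   over [Pi]; what remains is linear in [Pi] apart from its constant trace. *)
Lemma projection_objectiveE {R : realType} {m n : nat} (alpha : R)
    (Y Xb : 'M[R]_(m, n)) (G Pi : 'M[R]_n) :
  Pi^T = Pi -> Pi *m Pi = Pi -> Xb *m Pi = Xb -> G^T = G ->
  fnorm (Y - Xb) ^+ 2 + alpha * fnorm (1%:M - G - (1%:M - Pi)) ^+ 2 =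
  fnorm Y ^+ 2 + alpha * (fnorm G ^+ 2 + \tr Pi)
    + fnorm (Y *m Pi - Xb) ^+ 2 - \tr ((Y^T *m Y + (2 * alpha) *: G) *m Pi).
Proof.
move=> PiT PiPi XbPi GT.
have -> : 1%:M - G - (1%:M - Pi) = Pi - G.
  by rewrite opprB addrC addrA subrK.
rewrite !fnorm_sqrB (fnorm_sqr Pi) (fnorm_sqr (Y *m Pi)) !trmx_mul PiT PiPi.
have -> : \tr (Pi *m Y^T *m (Y *m Pi)) = \tr (Y^T *m Y *m Pi).
  by rewrite mulmxA mxtrace_mulC !mulmxA PiPi -mulmxA mxtrace_mulC.
have -> : \tr (Pi *m Y^T *m Xb) = \tr (Y^T *m Xb).
  by rewrite -mulmxA mxtrace_mulC -mulmxA XbPi.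
rewrite mulmxDl raddfD /= -scalemxAl mxtraceZ (mxtrace_mulC G); ring.
Qed.

(** * The matrix [D] and the constraint set *)

Lemma tr_singular_value_mx {R : realType} {r : nat} (S : 'M[R]_r) :
  is_singular_value_mx S -> S^T = S.
Proof.
case=> /is_diag_mxP S_diag _ _; apply/matrixP => i j; rewrite mxE.
have [-> //|ij] := eqVneq i j.
by rewrite !S_diag // eq_sym.
Qed.

(* Factors [D] through [X + Xdot = row_mx (U S + K) (U S) *m (row_mx V Vp)^T]
   plus the Gram part of the second component. *)
Lemma DmxE {R : realType} {m r : nat} (alpha : R) (U K : 'M[R]_(m, r))
    (S : 'M[R]_r) :
  stiefel U -> S^T = S ->
  Dmx alpha U S K =
    (row_mx (U *m S + K) (U *m S))^T *m row_mx (U *m S + K) (U *m S)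
    + (2 * alpha) *: block_mx 1%:M 1%:M 1%:M 0.
Proof.
move=> UU ST; rewrite scale_block_mx scaler0 scalemx1.
rewrite tr_row_mx mul_col_row add_block_mx addr0.
rewrite /Dmx [(U *m S + K)^T]linearD /= trmx_mul ST.
rewrite !(mulmxDl, mulmxDr) !mulmxA.
rewrite -(mulmxA S U^T U) UU mulmx1 !addrA.
by rewrite [X in block_mx (X + _ + _)]addrAC.
Qed.

(** Passing to the complementary projection turns the rank condition into a trace condition, the
    form in which [Pi] enters the cost. *)
Lemma desingularizationP {R : realType} {m n r : nat} (X : 'M[R]_(m, n))
    (Pi : 'M[R]_n) :
  (r <= n)%N ->
  desingularization r (X, 1%:M - Pi) <->
  [/\ Pi^T = Pi, Pi *m Pi = Pi, \tr Pi = r%:R & X *m Pi = X].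
Proof.
move=> r_le; rewrite /desingularization /grassmann /=; split.
  move: (1%:M - Pi) (subKr 1%:M Pi) => P <- [[PT PP rkP] XP].
  split.
  - by rewrite linearB /= trmx1 PT.
  - by rewrite mulmxBr mulmx1 mulmxBl mul1mx PP subrr subr0.
  - by rewrite raddfB /= mxtrace1 mxtrace_idempotent // rkP natrB // opprB addrC subrK.
  - by rewrite mulmxBr mulmx1 XP subr0.
case=> PiT PiPi trPi XPi; have PP : (1%:M - Pi) *m (1%:M - Pi) = 1%:M - Pi.
  by rewrite mulmxBr mulmx1 mulmxBl mul1mx PiPi subrr subr0.
split; last by rewrite mulmxBr mulmx1 XPi subrr.
split=> //; first by rewrite linearB /= trmx1 PiT.
apply/eqP; rewrite -(eqr_nat R) -mxtrace_idempotent // raddfB /= mxtrace1 trPi.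
by rewrite natrB.
Qed.

Lemma gram_shift_form_ge0 {R : realType} {m r : nat} (B : 'M[R]_(m, r))
    (c : R) (v : 'rV[R]_r) :
  0 <= c -> 0 <= (v *m (B^T *m B + c%:M) *m v^T) 0 0.
Proof.
move=> c_ge0; rewrite mulmxDr mulmxDl mxE addr_ge0 //.
  have -> : v *m (B^T *m B) *m v^T = (v *m B^T) *m (v *m B^T)^T.
    by rewrite trmx_mul trmxK !mulmxA.
  exact: dotmx_ge0.
by rewrite mul_mx_scalar -scalemxAl mxE mulr_ge0 // dotmx_ge0.
Qed.

(** * Optimality of the computed point *)

Theorem proposition3p11 (R : realType) (m n r : nat)
  (hm : (0 < m)%N) (hn : (0 < n)%N) (hr : (0 < r)%N) (hrmn : (r < minn m n)%N)
  (alpha : R) (halpha : 0 < alpha)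
  (X : 'M[R]_(m, n)) (P : 'M[R]_n) (Xdot : 'M[R]_(m, n)) (Pdot : 'M[R]_n)
  (hXP : desingularization r (X, P))
  (hdot : tangent_space (@desingularization R m n r) (X, P) (Xdot, Pdot))
  (U : 'M[R]_(m, r)) (S : 'M[R]_r) (V : 'M[R]_(n, r))
  (hrep : is_representation (X, P) U S V)
  (K : 'M[R]_(m, r)) (Vp : 'M[R]_(n, r))
  (htrep : is_tangent_representation U S V (Xdot, Pdot) K Vp)
  (Q : 'M[R]_(n, minn n (r + r))) (T : 'M[R]_(minn n (r + r), r + r))
  (hqr : is_thin_qr (row_mx V Vp) Q T)
  (Ut : 'M[R]_(minn n (r + r), r))
  (heig : is_top_eigenvectors (T *m Dmx alpha U S K *m T^T) Ut)
  (Vt : 'M[R]_(n, r)) (hVt : Vt = Q *m Ut)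
  (Ub : 'M[R]_(m, r)) (Sb : 'M[R]_r) (H : 'M[R]_r)
  (hsvd : is_thin_svd ((X + Xdot) *m Vt) Ub Sb H)
  (Vb : 'M[R]_(n, r)) (hVb : Vb = Vt *m H) :
  is_representation (Ub *m Sb *m Vb^T, 1%:M - Vb *m Vb^T) Ub Sb Vb /\
  metric_projection r alpha (X + Xdot, P + Pdot)
    (Ub *m Sb *m Vb^T, 1%:M - Vb *m Vb^T).
Proof.
have r_le_n : (r <= n)%N by apply: ltnW; rewrite (leq_trans hrmn) // geq_minr.
have [UU VV S_sv XE PE] := hrep; rewrite /= in XE PE.
have [VpV XdotE PdotE] := htrep; rewrite /= in XdotE PdotE.
have [QQ _ AE] := hqr.
have [UbUb Sb_sv HH YVtE] := hsvd.
have [UtUt _] := heig.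
have ST := tr_singular_value_mx S S_sv.
set A := row_mx V Vp in AE.
set Y := X + Xdot in YVtE *.
set N := T *m Dmx alpha U S K *m T^T in heig.
pose F := row_mx (U *m S + K) (U *m S).
have YE : Y = F *m A^T.
  by rewrite /Y XE XdotE /F /A tr_row_mx mul_row_col mulmxDl addrA.
(* Expanded, [G] is [V *m V^T + Vp *m V^T + V *m Vp^T]. *)
pose G := A *m block_mx 1%:M 1%:M 1%:M 0 *m A^T.
have GT : G^T = G.
  by rewrite /G !trmx_mul trmxK tr_block_mx !trmx1 trmx0 mulmxA.
have BE : P + Pdot = 1%:M - G.
  rewrite PE PdotE /G /A tr_row_mx mul_row_block mul_row_col !mulmx1 mulmx0 addr0.
  by rewrite mulmxDl !opprD !addrA.
have ME : Y^T *m Y + (2 * alpha) *: G = Q *m N *m Q^T.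
  rewrite /N DmxE // YE -/F trmx_mul trmxK /G.
  rewrite (scalemxAl _ _ A^T) scalemxAr.
  have -> : Q *m (T *m (F^T *m F + (2 * alpha) *: block_mx 1%:M 1%:M 1%:M 0)
      *m T^T) *m Q^T
    = (Q *m T) *m (F^T *m F + (2 * alpha) *: block_mx 1%:M 1%:M 1%:M 0)
      *m (Q *m T)^T by rewrite trmx_mul !mulmxA.
  by rewrite -AE mulmxDr mulmxDl !mulmxA.
have NT : N^T = N.
  rewrite /N !trmx_mul trmxK DmxE // [(_ + _)^T]linearD /= trmx_mul trmxK.
  by rewrite linearZ /= tr_block_mx !trmx1 trmx0 mulmxA.
(* The columns of [V] lie in the range of [Q], so their coordinates [Z] remain orthonormal. *)
pose Z := Q^T *m V.
have VQ : V = Q *m lsubmx T by rewrite mulmx_lsub -AE row_mxKl.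
have QZ : Q *m Z = V by rewrite /Z {1}VQ (mulmxA Q^T) QQ mul1mx -VQ.
have ZZ : Z^T *m Z = 1%:M.
  by rewrite {1}/Z trmx_mul trmxK -mulmxA QZ VV.
(* This equals [A^T *m V]; it selects the upper left block of [D]. *)
have TZ : T^T *m Z = col_mx 1%:M 0.
  by rewrite /Z mulmxA -trmx_mul -AE /A tr_row_mx mul_col_mx VV VpV.
have Z_psd (v : 'rV[R]_r) : 0 <= (v *m (Z^T *m N *m Z) *m v^T) 0 0.
  have -> : Z^T *m N *m Z = (U *m S + K)^T *m (U *m S + K) + (2 * alpha)%:M.
    have -> : Z^T *m N *m Z = (T^T *m Z)^T *m Dmx alpha U S K *m (T^T *m Z).
      by rewrite [(T^T *m Z)^T]trmx_mul trmxK /N !mulmxA.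
    rewrite TZ DmxE // tr_row_mx mul_col_row scale_block_mx add_block_mx.
    rewrite tr_col_mx trmx1 trmx0 mul_row_block mul_row_col.
    by rewrite !mulmx1 !mul1mx !mulmx0 !mul0mx !addr0 scalemx1.
  by apply: gram_shift_form_ge0; rewrite mulr_ge0 // ltW.
have HHt : H *m H^T = 1%:M by apply: mulmx1C.
have VtVt : Vt^T *m Vt = 1%:M.
  by rewrite hVt trmx_mul -mulmxA (mulmxA Q^T) QQ mul1mx.
pose Pi := Vt *m Vt^T.
have VbVb : Vb *m Vb^T = Pi.
  by rewrite hVb trmx_mul -mulmxA (mulmxA H) HHt mul1mx.
(* The output is thus the best first component over [Pi], and its residual in the cost vanishes. *)
have XbE : Ub *m Sb *m Vb^T = Y *m Pi.
  by rewrite hVb trmx_mul /Pi !mulmxA YVtE.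
have PiT : Pi^T = Pi by rewrite trmx_mul trmxK.
have PiPi : Pi *m Pi = Pi by rewrite /Pi -mulmxA (mulmxA Vt^T) VtVt mul1mx.
have trPi : \tr Pi = r%:R by rewrite mxtrace_mulC VtVt mxtrace1.
have YPiPi : Y *m Pi *m Pi = Y *m Pi by rewrite -mulmxA PiPi.
split.
  split=> //.
  by rewrite /stiefel /= hVb trmx_mul -mulmxA (mulmxA Vt^T) VtVt mul1mx.
rewrite VbVb XbE; split; first exact/desingularizationP.
case=> X' P' /=; rewrite BE -[P'](subKr 1%:M); set Pi' := 1%:M - P'.
case/desingularizationP=> // Pi'T Pi'Pi' trPi' X'Pi'.
rewrite !projection_objectiveE // subrr ME trPi trPi'.
have -> : fnorm (0 : 'M[R]_(m, n)) ^+ 2 = 0 by rewrite fnorm_sqr mulmx0 raddf0.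
have -> : \tr (Q *m N *m Q^T *m Pi) = \tr (Ut^T *m N *m Ut).
  rewrite /Pi mulmxA mxtrace_mulC hVt trmx_mul !mulmxA.
  by rewrite -(mulmxA _ Q^T Q) QQ mulmx1 -(mulmxA _ Q^T Q) QQ mulmx1.
have -> : \tr (Q *m N *m Q^T *m Pi') = \tr ((Q^T *m Pi')^T *m N *m (Q^T *m Pi')).
  by rewrite trmx_mul trmxK Pi'T -{1}Pi'Pi' mulmxA mxtrace_mulC !mulmxA.
(* The constants agree since both projections have trace [r]; what remains is the competitor's
   residual and the comparison of traces. *)
apply: lerB.
  by rewrite lerD2l sqr_ge0.
apply: (trace_le_top_eigenvectors N Ut Z) => //.
- by rewrite hr leq_min r_le_n leq_addr.
(* [Q *m Q^T] is an orthogonal projection, so compressing by it cannot increase the trace [r] of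
   [Pi']. *)
- have -> : (Q^T *m Pi')^T *m (Q^T *m Pi') = Pi'^T *m (Q *m Q^T) *m Pi'.
    by rewrite trmx_mul trmxK !mulmxA.
  rewrite -trPi' -[in leRHS]Pi'Pi' -{3}Pi'T; apply: mxtrace_projection_le.
    by rewrite trmx_mul trmxK.
  by rewrite -mulmxA (mulmxA Q^T) QQ mul1mx.
(* The bound by 1: [Pi'] does not increase the norm of [Q *m v^T], and [Q] is an isometry. *)
move=> v; rewrite -!trace_mx11.
have -> : v *m (Q^T *m Pi' *m (Q^T *m Pi')^T) *m v^T
    = (Q *m v^T)^T *m Pi' *m (Q *m v^T).
  by rewrite !trmx_mul !trmxK Pi'T -(mulmxA Q^T) (mulmxA Pi') Pi'Pi' !mulmxA.
apply: le_trans (mxtrace_projection_le Pi' _ Pi'T Pi'Pi') _.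
by rewrite trmx_mul trmxK -mulmxA (mulmxA Q^T) QQ mul1mx.
Qed.
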